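(* Assume $a_{cmin}\le a_{fmin}$ and $a_{cmax}\le a_{fmax}$. Then the condition number $\kappa=\kappa(\alpha)$ of $\mathbf A_\alpha$ is minimized over $\alpha\in(0,1]$ by choosing $$\alpha_{opt}=\frac{1}{1+a_{fmin}-a_{cmin}}\le 1,$$ resulting in the optimal value $$\kappa_{opt}=\begin{cases}\dfrac{a_{fmax}}{a_{fmin}} & \text{if } a_{fmax}-a_{fmin}\ge a_{cmax}-a_{cmin},\\[2mm] 1+\dfrac{a_{cmax}-a_{cmin}}{a_{fmin}} & \text{otherwise.}\end{cases}$$
   Context: Let $\mathbf A\in\mathbb R^{N\times N}$ be symmetric positive-definite with eigenvalues $a_i$ and corresponding orthogonal eigenvectors $\mathbf a_i$, $i=1,\dots,N$. The columns of the prolongation matrix $\mathbf I_H^h$ are a nonempty proper subset of $\{\mathbf a_1,\dots,\mathbf a_N\}$, and $\mathcal R(\mathbf I_H^h)$ denotes the range (column space) of $\mathbf I_H^h$. The coarse-grid matrix is the Galerkin one, $\mathbf A_H=(\mathbf I_H^h)^{\mathcal T}\mathbf A\,\mathbf I_H^h$. For $\alpha\in(0,1]$, $$\mathbf A_\alpha=\left(\alpha\mathbf I+(1-\alpha)\mathbf I_H^h\mathbf A_H^{-1}(\mathbf I_H^h)^{\mathcal T}\right)\mathbf A,$$ with $\mathbf I$ the identity; its eigenvalues are real and positive, and its condition number $\kappa$ is the ratio of its largest to its smallest eigenvalue. Denote $$a_{fmax}=\max_{i:\mathbf a_i\notin\mathcal R(\mathbf I_H^h)}a_i,\quad a_{fmin}=\min_{i:\mathbf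 a_i\notin\mathcal R(\mathbf I_H^h)}a_i,\quad a_{cmax}=\max_{i:\mathbf a_i\in\mathcal R(\mathbf I_H^h)}a_i,\quad a_{cmin}=\min_{i:\mathbf a_i\in\mathcal R(\mathbf I_H^h)}a_i.$$ *)

(* Defs.v *)
From mathcomp Require Import all_boot all_order all_algebra reals.

Set Implicit Arguments.
Unset Strict Implicit.
Unset Printing Implicit Defensive.

Import Order.TTheory GRing.Theory Num.Theory.
Local Open Scope ring_scope.

Definition is_max (R : realType) (S : R -> Prop) (m : R) : Prop :=
  S m /\ forall x, S x -> x <= m.

Definition is_min (R : realType) (S : R -> Prop) (m : R) : Prop :=
  S m /\ forall x, S x -> m <= x.

Definition spd (R : realType) (N : nat) (A : 'M[R]_N) : Prop :=
  A^T = A /\ forall v : 'cV[R]_N, v != 0 -> 0 < (v^T *m A *m v) 0 0.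

(* The eigenvectors are nonzero and pairwise orthogonal, not necessarily
   normalized; the eigenvalues a i may be repeated. *)
Definition orthogonal_eigenvectors (R : realType) (N : nat) (A : 'M[R]_N)
    (a : 'I_N -> R) (e : 'I_N -> 'cV[R]_N) : Prop :=
  [/\ forall i, e i != 0,
      forall i, A *m e i = a i *: e i
    & forall i j, i != j -> (e i)^T *m e j = 0].

(* %MS compares row spaces, hence the transpositions: v = P *m w for some w. *)
Definition in_range (R : realType) (N n : nat) (P : 'M[R]_(N, n))
    (v : 'cV[R]_N) : bool := (v^T <= P^T)%MS.

Definition prolongation (R : realType) (N n : nat) (e : 'I_N -> 'cV[R]_N)
    (c : 'I_n -> 'I_N) : 'M[R]_(N, n) := \matrix_(i, j) e (c j) i 0.

Definition coarse_mx (R : realType) (N n : nat) (A : 'M[R]_N)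
    (P : 'M[R]_(N, n)) : 'M[R]_n := P^T *m A *m P.

Definition A_alpha (R : realType) (N n : nat) (A : 'M[R]_N)
    (P : 'M[R]_(N, n)) (alpha : R) : 'M[R]_N :=
  (alpha%:M + (1 - alpha) *: (P *m invmx (coarse_mx A P) *m P^T)) *m A.

(* [eigenvalue] is phrased with row eigenvectors; left and right eigenvalues of
   a square matrix coincide.  Only real eigenvalues are considered, which is
   all of them for the matrices A_alpha. *)
Definition is_condition_number (R : realType) (N : nat) (M : 'M[R]_N)
    (kappa : R) : Prop :=
  exists lmax lmin : R,
    [/\ is_max (fun l => eigenvalue M l) lmax,
        is_min (fun l => eigenvalue M l) lmin
      & kappa = lmax / lmin].

Definition fine_eigenvalue (R : realType) (N n : nat) (a : 'I_N -> R)
    (e : 'I_N -> 'cV[R]_N) (P : 'M[R]_(N, n)) (x : R) : Prop :=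
  exists2 i, ~~ in_range P (e i) & x = a i.

Definition coarse_eigenvalue (R : realType) (N n : nat) (a : 'I_N -> R)
    (e : 'I_N -> 'cV[R]_N) (P : 'M[R]_(N, n)) (x : R) : Prop :=
  exists2 i, in_range P (e i) & x = a i.

Definition alpha_opt (R : realType) (afmin acmin : R) : R :=
  1 / (1 + afmin - acmin).

Definition kappa_opt (R : realType) (afmax afmin acmax acmin : R) : R :=
  if afmax - afmin >= acmax - acmin then afmax / afmin
  else 1 + (acmax - acmin) / afmin.

(* Main.v *)
(** Every eigenvector [e i] of [A] is an eigenvector of [A_alpha]: on the range of
    [P] the coarse correction [P A_H^-1 P^T A] is the identity, and it kills the
    eigenvectors outside the range.  Hence the spectrum of [A_alpha] consists of
    [alpha a_i] (fine) and [alpha a_i + 1 - alpha] (coarse), with minimum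
    [min F C], where [F = alpha afmin] and [C = alpha acmin + 1 - alpha].
    The value [alpha_opt] is the solution of [F = C].  The lower bound
    [afmax / afmin] is immediate, and with [d = acmax - acmin] one has
    [(C + alpha d) / min F C >= 1 + alpha d / F = 1 + d / afmin]. *)
Require Import Defs.
From mathcomp Require Import all_boot all_order all_algebra reals.
From mathcomp Require Import ring lra.

Set Implicit Arguments.
Unset Strict Implicit.
Unset Printing Implicit Defensive.

Import Order.TTheory GRing.Theory Num.Theory.
Local Open Scope ring_scope.

Lemma dotmx_gt0 (R : realFieldType) (N : nat) (v : 'cV[R]_N) :
  v != 0 -> 0 < (v^T *m v) 0 0.
Proof.
move=> v0; rewrite mxE lt_neqAle eq_sym sumr_ge0 ?andbT => [|i _]; last first.
  by rewrite mxE -expr2 sqr_ge0.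
apply: contra v0; rewrite psumr_eq0 => [/allP h|i _]; last first.
  by rewrite mxE -expr2 sqr_ge0.
apply/eqP/colP => i; have := h i (mem_index_enum _).
by rewrite !mxE mulf_eq0 orbb => /eqP.
Qed.

Section VectorFamily.

Variables (R : realFieldType) (N n : nat) (f : 'I_n -> 'cV[R]_N).

Definition cols_mx : 'M[R]_(N, n) := \matrix_(i, j) f j i 0.

Lemma col_cols_mx j : col j cols_mx = f j.
Proof. by apply/colP => k; rewrite !mxE. Qed.

Lemma mulmx_cols_mx (M : 'M[R]_N) (mu : 'I_n -> R) :
  (forall j, M *m f j = mu j *: f j) ->
  M *m cols_mx = cols_mx *m diag_mx (\row_j mu j).
Proof.
move=> hM; apply/matrixP => i j; have /colP/(_ i) := hM j.
rewrite mul_mx_diag !mxE mulrC => <-.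
by apply: eq_bigr => k _; rewrite !mxE.
Qed.

(** Orthogonality makes the Gram matrix diagonal, with the positive squared norms of the [f j] on
    the diagonal. It serves both the full eigenbasis and the columns of [P]. *)
Lemma gram_cols_mx_unit :
  (forall j, f j != 0) -> (forall j k, j != k -> (f j)^T *m f k = 0) ->
  cols_mx^T *m cols_mx \in unitmx.
Proof.
move=> f_neq0 f_orth.
have -> : cols_mx^T *m cols_mx = diag_mx (\row_j ((f j)^T *m f j) 0 0).
  apply/matrixP => j k; rewrite mxE [RHS]mxE mxE.
  have -> : \sum_l cols_mx^T j l * cols_mx l k = ((f j)^T *m f k) 0 0.
    by rewrite mxE; apply: eq_bigr => l _; rewrite !mxE.
  by have [->//|/f_orth->] := eqVneq j k; rewrite mulr0n mxE.
rewrite unitmxE det_diag unitfE; apply/prodf_neq0 => j _.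
by rewrite mxE gt_eqF ?dotmx_gt0.
Qed.

End VectorFamily.

(** The matrix [E] of the [e i] is invertible and [M E = E D] with [D] diagonal. For a row
    eigenvector [v], any nonzero coordinate of [v E] singles out the index; conversely, the rows of
    [invmx E] are row eigenvectors. *)
Lemma eigenvalue_orthogonal_family (R : realFieldType) (N : nat)
    (e : 'I_N -> 'cV[R]_N) (M : 'M[R]_N) (mu : 'I_N -> R) (l : R) :
  (forall i, e i != 0) -> (forall i j, i != j -> (e i)^T *m e j = 0) ->
  (forall i, M *m e i = mu i *: e i) ->
  eigenvalue M l <-> exists i, l = mu i.
Proof.
move=> e0 e_orth hM; set E := cols_mx e.
have uE : E \in unitmx.
  by have := gram_cols_mx_unit e0 e_orth; rewrite unitmx_mul => /andP[].
have ME : M *m E = E *m diag_mx (\row_i mu i) := mulmx_cols_mx hM.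
split=> [/eigenvalueP[v vM v0]|[i ->]].
- have w0 : v *m E != 0.
    by apply: contraNneq v0 => w; rewrite -[v](mulmxK uE) w mul0mx.
  have [i wi] := rV0Pn _ w0; exists i; apply: (mulIf wi).
  have := congr1 (fun x : 'rV_N => (x *m E) 0 i) vM.
  rewrite -mulmxA ME mulmxA mul_mx_diag -scalemxAl mxE [in X in _ = X]mxE => <-.
  by rewrite [in X in _ * X]mxE mulrC.
- apply/eigenvalueP; exists (row i (invmx E)).
    rewrite -row_mul -[M in LHS](mulmxK uE) ME mulmxA mulmxA mulVmx // mul1mx.
    by apply/rowP => k; rewrite mul_diag_mx !mxE.
  apply: contra_neq (oner_neq0 R) => r0.
  have := congr1 (fun x : 'rV_N => (x *m E) 0 i) r0.
  by rewrite -row_mul mulVmx // mul0mx !mxE eqxx.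
Qed.

Section TwoGrid.

Variables (R : realType) (N n : nat) (A : 'M[R]_N) (P : 'M[R]_(N, n)).
Hypothesis uAH : coarse_mx A P \in unitmx.

(** With [v = P w], the factor [P^T A P] produced by [P^T A v] cancels against [A_H^-1]. *)
Lemma A_alpha_coarse (alpha x : R) (v : 'cV[R]_N) :
  A *m v = x *: v -> in_range P v ->
  A_alpha A P alpha *m v = (alpha * x + (1 - alpha)) *: v.
Proof.
move=> Av /submxP[w /(congr1 trmx)]; rewrite trmx_mul !trmxK => vE.
have corr : P *m invmx (coarse_mx A P) *m P^T *m (A *m v) = v.
  rewrite {1}vE -!mulmxA [P^T *m _]mulmxA [_ *m (P *m _)]mulmxA.
  by rewrite [invmx _ *m _]mulmxA mulVmx // mul1mx -vE.
rewrite /A_alpha -mulmxA mulmxDl -scalemxAl corr Av mul_scalar_mx.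
by rewrite scalerA -scalerDl.
Qed.

Lemma A_alpha_fine (alpha x : R) (v : 'cV[R]_N) :
  A *m v = x *: v -> P^T *m v = 0 -> A_alpha A P alpha *m v = (alpha * x) *: v.
Proof.
move=> Av Pv; rewrite /A_alpha -mulmxA mulmxDl -scalemxAl Av.
rewrite mul_scalar_mx -scalemxAr -!mulmxA Pv !mulmx0 !scaler0 addr0.
by rewrite scalerA.
Qed.

End TwoGrid.

Theorem theorem3p8 (R : realType) (N n : nat) (A : 'M[R]_N)
    (a : 'I_N -> R) (e : 'I_N -> 'cV[R]_N)
    (c : 'I_n -> 'I_N) (P : 'M[R]_(N, n))
    (afmax afmin acmax acmin : R)
    (hA : spd A)
    (he : orthogonal_eigenvectors A a e)
    (hc : injective c) (hn0 : (0 < n)%N) (hnN : (n < N)%N)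
    (hP : P = prolongation e c)
    (hafmax : is_max (fine_eigenvalue a e P) afmax)
    (hafmin : is_min (fine_eigenvalue a e P) afmin)
    (hacmax : is_max (coarse_eigenvalue a e P) acmax)
    (hacmin : is_min (coarse_eigenvalue a e P) acmin)
    (hmin : acmin <= afmin) (hmax : acmax <= afmax) :
  [/\ 0 < alpha_opt afmin acmin <= 1,
      is_condition_number (A_alpha A P (alpha_opt afmin acmin))
        (kappa_opt afmax afmin acmax acmin)
    & forall alpha : R, 0 < alpha <= 1 ->
        exists2 kappa : R, is_condition_number (A_alpha A P alpha) kappa
          & kappa_opt afmax afmin acmax acmin <= kappa].
Proof.
have [e0 eig e_orth] := he; have [_ posA] := hA.
have a_gt0 i : 0 < a i.
  have := posA _ (e0 i).
  by rewrite -mulmxA eig -scalemxAr mxE pmulr_lgt0 // dotmx_gt0.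
(* This is [hP] up to conversion. *)
have PE : P = cols_mx (e \o c) by [].
have uAH : coarse_mx A P \in unitmx.
  (* [A P = P D] with [D] the diagonal of the selected eigenvalues, so the coarse matrix is the Gram
     matrix of [P] times an invertible diagonal. *)
  rewrite /coarse_mx -mulmxA PE (mulmx_cols_mx (mu := a \o c)) => [|j]; last first.
    exact: eig.
  rewrite mulmxA unitmx_mul gram_cols_mx_unit /= => [|j|j k jk].
  - rewrite unitmxE det_diag unitfE; apply/prodf_neq0 => j _.
    by rewrite mxE gt_eqF ?a_gt0.
  - exact: e0.
  - by apply: e_orth; apply: contra jk => /eqP/hc->.
have colP j : col j P = e (c j) by rewrite PE col_cols_mx.
have fine_orth i : ~~ in_range P (e i) -> P^T *m e i = 0.
  (* Row [j] is the inner product of [e (c j)] and [e i]; [c j = i] would make [e i] a column of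
     [P]. *)
  move=> iP; apply/row_matrixP => j; rewrite row0 row_mul -tr_col colP.
  rewrite e_orth //; apply: contra iP => /eqP <-.
  by rewrite /in_range -colP tr_col row_sub.
pose mu alpha i := alpha * a i + (if in_range P (e i) then 1 - alpha else 0).
have spec alpha l : eigenvalue (A_alpha A P alpha) l <-> exists i, l = mu alpha i.
  apply: (eigenvalue_orthogonal_family _ e0 e_orth) => i; rewrite /mu.
  case: ifPn => [iP|/fine_orth iP]; first exact: A_alpha_coarse.
  by rewrite addr0; apply: A_alpha_fine.
have [[ifM ifMP ifME] hfM] := hafmax; have [[ifm ifmP ifmE] hfm] := hafmin.
have [[icM icMP icME] hcM] := hacmax; have [[icm icmP icmE] hcm] := hacmin.
have cond alpha : 0 < alpha <= 1 -> is_condition_number (A_alpha A P alpha)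
    (Num.max (alpha * afmax) (alpha * acmax + (1 - alpha))
     / Num.min (alpha * afmin) (alpha * acmin + (1 - alpha))).
  (* Since [alpha > 0], the order within each class is preserved, so each extremum is attained at
     the extremal index of one of the two classes. *)
  move=> /andP[al0 al1]; eexists; eexists; split; last reflexivity.
  - split=> [|l /spec[i ->]]; first apply/spec; rewrite /mu.
      case: leP => _; [exists icM | exists ifM];
        by rewrite ?icMP ?(negPf ifMP) ?addr0 ?icME ?ifME.
    case: ifPn => iP; rewrite le_max ?addr0 ?lerD2r !ler_pM2l //.
      by rewrite (hcM (a i)) ?orbT //; exists i.
    by rewrite (hfM (a i)) //; exists i.
  - split=> [|l /spec[i ->]]; first apply/spec; rewrite /mu.
      case: leP => _; [exists ifm | exists icm];
        by rewrite ?icmP ?(negPf ifmP) ?addr0 ?icmE ?ifmE.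
    case: ifPn => iP; rewrite ge_min ?addr0 ?lerD2r !ler_pM2l //.
      by rewrite (hcm (a i)) ?orbT //; exists i.
    by rewrite (hfm (a i)) //; exists i.
have af0 : 0 < afmin by rewrite ifmE.
have ac0 : 0 < acmin by rewrite icmE.
have acM : acmin <= acmax by apply: hcM; exists icm.
(* By [hmin] this denominator is even at least 1, whence [alpha_opt <= 1]. *)
have s0 : 0 < 1 + afmin - acmin by lra.
have opt : 0 < alpha_opt afmin acmin <= 1.
  by rewrite /alpha_opt divr_gt0 //= ler_pdivrMr // mul1r; lra.
split=> // [|alpha hal].
- have := cond _ opt; congr (is_condition_number _ _).
  set al := alpha_opt _ _ in opt *; have /andP[al0 _] := opt.
  (* This makes every extreme value a multiple of [al]: both minima become [al * afmin], and [al]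
     cancels from the ratio. *)
  have Copt : 1 - al = al * (afmin - acmin).
    by rewrite /al /alpha_opt; field; rewrite gt_eqF.
  rewrite Copt -!mulrDr [acmin + _]addrC subrK minxx -maxr_pMr ?ltW //.
  rewrite -mulf_div divff ?gt_eqF // mul1r /kappa_opt.
  case: leP => h; [rewrite max_l; last lra | rewrite max_r; last lra].
    by [].
  by field; rewrite gt_eqF.
- eexists; first exact: cond.
  have /andP[al0 al1] := hal.
  set F := alpha * afmin; set C := alpha * acmin + _.
  have F0 : 0 < F by rewrite mulr_gt0.
  have C0 : 0 < C by rewrite ltr_wpDr ?subr_ge0 // mulr_gt0.
  have m0 : 0 < Num.min F C by rewrite lt_min F0.
  rewrite ler_pdivlMr // /kappa_opt; case: ifP => _.
    rewrite le_max; apply/orP; left.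
    (* The fine maximum [alpha * afmax] is exactly [afmax / afmin * F]. *)
    apply: (@le_trans _ _ (afmax / afmin * F)).
      by rewrite ler_wpM2l ?ge_min ?lexx // divr_ge0 //; lra.
    by rewrite mulrCA divfK ?gt_eqF.
  rewrite le_max; apply/orP; right; rewrite mulrDl mul1r.
  (* In this form [C] and [F] can each be bounded below by [Num.min F C], term by term. *)
  have -> : alpha * acmax + (1 - alpha) = C + (acmax - acmin) / afmin * F.
    by rewrite /C /F; field; rewrite gt_eqF.
  apply: lerD; first by rewrite ge_min lexx orbT.
  by rewrite ler_wpM2l ?ge_min ?lexx // divr_ge0 ?subr_ge0 // ltW.
Qed.
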